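(* Let $G$ be a group, let $A$ be a finite set with $|A|\ge 2$, and let $\phi,\psi\in\mathrm{Aut}(G)$. Then: 1. $(\phi\circ\psi)_{\mathrm{CA}} = \phi_{\mathrm{CA}}\circ\psi_{\mathrm{CA}}$. 2. $\phi_{\mathrm{CA}} \in \mathrm{Aut}(\mathrm{CA}(G;A))$, i.e. $\phi_{\mathrm{CA}}$ is an automorphism of the monoid $\mathrm{CA}(G;A)$.
   Context: $A^G$ is the set of all functions $x : G \to A$, with the shift action $(g\cdot x)(h) := x(g^{-1}h)$ for $x \in A^G$, $g,h\in G$. $\mathrm{CA}(G;A)$ is the monoid, under composition, of all cellular automata over $A^G$, i.e. functions $\tau : A^G \to A^G$ for which there are a finite subset $S\subseteq G$ and a function $\mu : A^S\to A$ with $\tau(x)(g) = \mu((g^{-1}\cdot x)|_S)$ for all $x\in A^G$, $g \in G$. For $\phi\in\mathrm{Aut}(G)$, $\phi^\star : A^G\to A^G$ is $\phi^\star(x) := x\circ\phi$, and $\phi_{\mathrm{CA}} : \mathrm{CA}(G;A)\to\mathrm{CA}(G;A)$ is the map $\phi_{\mathrm{CA}}(\tau) := (\phi^{-1})^\star\circ\tau\circ\phi^\star$ (which does take values in $\mathrm{CA}(G;A)$). *)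

(* Defs.v *)
From HB Require Import structures.
From mathcomp Require Import all_boot finmap boolp.

Set Implicit Arguments.
Unset Strict Implicit.
Unset Printing Implicit Defensive.

Local Open Scope fset_scope.
Local Open Scope group_scope.

(* The library's Aut is restricted to finite groups, hence this definition,
   which covers groups and monoids alike: a map between groups is a group
   morphism as soon as it is a monoid morphism. *)
Definition is_automorphism (M : monoidType) (f : M -> M) : Prop :=
  monoid_morphism f /\ bijective f.

Record Aut (M : monoidType) := MkAut {
  aut_fun :> M -> M;
  autP : is_automorphism aut_fun
}.

Section Automorphisms.

Variable M : monoidType.
Implicit Types f g : Aut M.

Lemma aut_comp_subproof f g : is_automorphism (f \o g).
Proof.
have [[f1 fM] f_bij] := autP f; have [[g1 gM] g_bij] := autP g.
split; last exact: bij_comp.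
by split=> [|x y] /=; rewrite ?g1 ?f1 ?gM ?fM.
Qed.

Definition aut_comp f g : Aut M := MkAut (aut_comp_subproof f g).

Lemma aut_inv_exists f : exists g : M -> M, cancel f g /\ cancel g f.
Proof. by have [_ [g fK gK]] := autP f; exists g. Qed.

Definition aut_inv_fun f : M -> M := projT1 (cid (aut_inv_exists f)).

Lemma aut_funK f : cancel f (aut_inv_fun f).
Proof. by rewrite /aut_inv_fun; case: cid => g []. Qed.

Lemma aut_inv_funK f : cancel (aut_inv_fun f) f.
Proof. by rewrite /aut_inv_fun; case: cid => g []. Qed.

Lemma aut_inv_subproof f : is_automorphism (aut_inv_fun f).
Proof.
have [[f1 fM] f_bij] := autP f; have f_inj := bij_inj f_bij.
split; last by exists f; [exact: aut_inv_funK | exact: aut_funK].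
by split=> [|x y]; apply: f_inj; rewrite ?fM !aut_inv_funK ?f1.
Qed.

Definition aut_inv f : Aut M := MkAut (aut_inv_subproof f).

End Automorphisms.

Definition shift (G : groupType) (A : Type) (g : G) (x : G -> A) : G -> A :=
  fun h => x (g^-1 * h).

Definition restrict (G : groupType) (A : Type) (S : {fset G}) (x : G -> A) :
    S -> A :=
  fun s => x (val s).

Definition is_CA (G : groupType) (A : finType) (tau : (G -> A) -> G -> A) :
    Prop :=
  exists (S : {fset G}) (mu : (S -> A) -> A),
    forall (x : G -> A) (g : G), tau x g = mu (restrict (shift g^-1 x)).

Record CA (G : groupType) (A : finType) := MkCA {
  CA_fun :> (G -> A) -> G -> A;
  CAP : `[< is_CA CA_fun >]
}.

Section CellularAutomata.

Variables (G : groupType) (A : finType).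

HB.instance Definition _ := [isSub for @CA_fun G A].
HB.instance Definition _ := [Choice of CA G A by <:].

Lemma CA_ext (sigma tau : CA G A) : CA_fun sigma = CA_fun tau -> sigma = tau.
Proof. exact: val_inj. Qed.

Lemma CA_id_subproof : `[< is_CA (@id (G -> A)) >].
Proof.
apply/asboolP; exists (fset1 1), (fun y => y [` fset11 1]) => x g.
by rewrite /restrict /shift /= invgK mulg1.
Qed.

Lemma CA_comp_subproof (tau sigma : CA G A) : `[< is_CA (tau \o sigma) >].
Proof.
have /asboolP [S [mu tauE]] := CAP tau.
have /asboolP [T [nu sigmaE]] := CAP sigma.
pose ST := [fset s * t | s in S, t in T].
have memST (s : S) (t : T) : val s * val t \in ST.
  by apply: in_imfset2; [exact: valP | exact: valP].
apply/asboolP.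
exists ST, (fun y => mu (fun s => nu (fun t => y [` memST s t]))) => x g.
rewrite /= tauE; congr mu; apply/funext => s.
rewrite /restrict /shift /= sigmaE; congr nu; apply/funext => t.
by rewrite /restrict /shift /= !invgK mulgA.
Qed.

Definition CA_id : CA G A := MkCA CA_id_subproof.
Definition CA_comp (tau sigma : CA G A) : CA G A :=
  MkCA (CA_comp_subproof tau sigma).

Lemma CA_compA : associative CA_comp.
Proof. by move=> r s t; apply: CA_ext. Qed.
Lemma CA_1comp : left_id CA_id CA_comp.
Proof. by move=> t; apply: CA_ext. Qed.
Lemma CA_comp1 : right_id CA_id CA_comp.
Proof. by move=> t; apply: CA_ext. Qed.

HB.instance Definition _ :=
  isMonoid.Build (CA G A) CA_compA CA_1comp CA_comp1.

End CellularAutomata.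

Definition pullback (G : groupType) (A : Type) (phi : Aut G) (x : G -> A) :
    G -> A :=
  x \o phi.

Lemma aut_CA_subproof (G : groupType) (A : finType) (phi : Aut G)
    (tau : CA G A) :
  `[< is_CA (pullback (aut_inv phi) \o tau \o pullback phi) >].
Proof.
have [[_ phiM] _] := autP phi; have /asboolP [S [mu tauE]] := CAP tau.
have mem_phi (s : S) : phi (val s) \in [fset phi u | u in S].
  by apply: in_imfset; exact: valP.
apply/asboolP.
exists [fset phi u | u in S], (fun y => mu (fun s => y [` mem_phi s])).
move=> x g; rewrite /= /pullback /= tauE; congr mu; apply/funext => s.
by rewrite /restrict /shift /= !invgK phiM aut_inv_funK.
Qed.

Definition aut_CA (G : groupType) (A : finType) (phi : Aut G) (tau : CA G A) :
    CA G A :=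
  MkCA (aut_CA_subproof phi tau).

(* Main.v *)
Require Import Defs.
From mathcomp Require Import all_boot.
From mathcomp Require Import boolp.

(** The map sending [phi] to [aut_CA phi] is conjugation by the bijection
    [pullback phi] of the configuration space. Since [pullback] reverses
    composition and conjugation by it uses the inverse on the left, the two
    reversals cancel and the assignment is covariant: this is [aut_CA_comp],
    which rests on the formula [aut_comp_inv] for the inverse of a composite.
    As conjugation, [aut_CA phi] respects composition of cellular automata
    ([aut_CA_morphism]). Covariance together with triviality at the identity
    ([aut_CA_id]) then shows that [aut_CA (aut_inv phi)] is a two-sided inverse
    of [aut_CA phi]. *)

Local Open Scope group_scope.

(** Unlike an equality in [Aut M], this pointwise form involves no comparison
    of the automorphism proofs carried by the two sides. *)
Lemma aut_comp_inv (M : monoidType) (f g : Aut M) :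
  aut_inv (aut_comp f g) =1 aut_inv g \o aut_inv f.
Proof.
move=> x; apply: (can_inj (aut_funK (aut_comp f g))).
by rewrite aut_inv_funK /= !aut_inv_funK.
Qed.

Section ConjugationByAutomorphisms.

Variables (G : groupType) (A : finType).
Implicit Types (phi psi : Aut G) (tau : CA G A).

Lemma aut_CAE phi tau (x : G -> A) g :
  aut_CA phi tau x g = tau (pullback phi x) (aut_inv phi g).
Proof. by []. Qed.

Lemma aut_CA_comp phi psi :
  @aut_CA G A (aut_comp phi psi) = @aut_CA G A phi \o @aut_CA G A psi.
Proof.
apply/funext => tau; apply: CA_ext; apply/funext => x; apply/funext => g.
by rewrite !aut_CAE aut_comp_inv.
Qed.

(** The hypothesis is pointwise so that the lemma applies directly to
    composites of an automorphism with its inverse. *)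
Lemma aut_CA_id phi : phi =1 id -> @aut_CA G A phi =1 id.
Proof.
move=> phi_id tau; apply: CA_ext; apply/funext => x; apply/funext => g.
have inv_id : aut_inv phi g = g by rewrite -[LHS]phi_id aut_inv_funK.
have pull_id : pullback phi x = x.
  by apply/funext => h; rewrite /pullback /= phi_id.
by rewrite aut_CAE pull_id inv_id.
Qed.

(** In a product of two conjugates the inner factors [pullback phi] and
    [pullback (aut_inv phi)] meet and cancel. *)
Lemma aut_CA_morphism phi : monoid_morphism (@aut_CA G A phi).
Proof.
split=> [|tau sigma]; apply: CA_ext; apply/funext => x.
  by apply/funext => g; rewrite /= /pullback /= aut_inv_funK.
have pullK y : pullback phi (pullback (aut_inv phi) y) = y :> (G -> A).
  by apply/funext => h; rewrite /pullback /= aut_funK.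
by rewrite /= pullK.
Qed.

Lemma aut_CA_bij phi : bijective (@aut_CA G A phi).
Proof.
exists (@aut_CA G A (aut_inv phi)) => tau.
  rewrite -[LHS]/((@aut_CA G A (aut_inv phi) \o @aut_CA G A phi) tau).
  by rewrite -aut_CA_comp aut_CA_id // => g; exact: aut_funK.
rewrite -[LHS]/((@aut_CA G A phi \o @aut_CA G A (aut_inv phi)) tau).
by rewrite -aut_CA_comp aut_CA_id // => g; exact: aut_inv_funK.
Qed.

End ConjugationByAutomorphisms.

Theorem proposition2 (G : groupType) (A : finType) (hA : (2 <= #|A|)%N)
    (phi psi : Aut G) :
  @aut_CA G A (aut_comp phi psi) = @aut_CA G A phi \o @aut_CA G A psi
  /\ is_automorphism (@aut_CA G A phi).
Proof.
split; first exact: aut_CA_comp.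
by split; [exact: aut_CA_morphism | exact: aut_CA_bij].
Qed.
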